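(* Fix $d\in\mathbb N$ and let $A\in SM_d(\mathbb C)^{d^2-1}$ be such that $\mathcal D_A$ is bounded. Then there exists $B\in SM_d(\mathbb C)^{d^2-1}$ with $\mathcal D_A^\circ=\mathcal D_B$. Consequently $\mathcal D_A=\mathrm{mconv}(B)$, $B$ is (up to unitary equivalence) the only free extreme point of $\mathcal D_A$, and $\mathcal D_A$ is the matrix convex hull of its free extreme points.
   Context: $SM_d(\mathbb C)^g$ denotes $g$-tuples of self-adjoint $d\times d$ complex matrices. $\mathcal D_A=\bigcup_n\{X\in SM_n(\mathbb C)^g: I-\sum_iA_i\otimes X_i\succeq0\}$. The free polar dual of a matrix convex set $K$ is $K^\circ=\{X\in SM^g:\sum_iY_i\otimes X_i\preceq I\ \forall Y\in K\}$. $\mathrm{mconv}(S)$ is the smallest set containing $S$ closed under matrix convex combinations $\sum_iV_i^*X^{(i)}V_i$, $\sum_iV_i^*V_i=I$. A point $X\in K(n)$ is a free extreme point of $K$ if whenever $X=\sum_iV_i^*X^{(i)}V_i$ with $X^{(i)}\in K$ and $V_i\neq0$, each $X^{(i)}$ is unitarily equivalent to $X$ or to $X\oplus Z$ for some $Z\in K$. *)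

(* Defs.v *)
From HB Require Import structures.
From mathcomp Require Import all_boot all_order all_algebra.
From mathcomp Require Import reals.
From mathcomp Require Import complex mxtens.

Set Implicit Arguments.
Unset Strict Implicit.
Unset Printing Implicit Defensive.

Import Order.TTheory GRing.Theory Num.Theory.
Local Open Scope ring_scope.

Section FreeConvexity.

Variable R : realType.
Local Notation C := (R[i]).

Definition adjmx (m n : nat) (M : 'M[C]_(m, n)) : 'M[C]_(n, m) :=
  (map_mx Num.conj M)^T.

Definition selfadj (n : nat) (M : 'M[C]_n) : Prop := adjmx M = M.

Definition psd (n : nat) (M : 'M[C]_n) : Prop :=
  selfadj M /\ forall v : 'cV[C]_n, 0 <= (adjmx v *m M *m v) 0 0.

Definition mtuple (g n : nat) := 'I_g -> 'M[C]_n.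

Definition SAtuple (g n : nat) (X : mtuple g n) : Prop := forall i, selfadj (X i).

(* free (noncommutative) sets: a set of g-tuples at every matrix level n >= 1;
   level n.+1 is indexed by n *)
Definition ncset (g : nat) := forall n : nat, mtuple g n.+1 -> Prop.

Definition ncset_eq (g : nat) (K L : ncset g) : Prop :=
  forall n (X : mtuple g n.+1), K n X <-> L n X.

Definition pencil (g d n : nat) (A : mtuple g d) (X : mtuple g n) : 'M[C]_(d * n) :=
  1%:M - \sum_(i < g) (A i *t X i).

Definition fspec (g d : nat) (A : mtuple g d) : ncset g :=
  fun n X => SAtuple X /\ psd (pencil A X).

Definition nc_bounded (g : nat) (K : ncset g) : Prop :=
  exists r : R, forall n (X : mtuple g n.+1), K n X ->
    forall i, psd ((r%:C%C)%:M - X i) /\ psd ((r%:C%C)%:M + X i).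

Definition fpolar (g : nat) (K : ncset g) : ncset g :=
  fun n X => SAtuple X /\
    forall m (Y : mtuple g m.+1), K m Y -> psd (pencil Y X).

Definition mconv_closed (g : nat) (K : ncset g) : Prop :=
  forall n (k : nat) (sz : 'I_k -> nat)
         (Xs : forall j : 'I_k, mtuple g (sz j).+1)
         (V : forall j : 'I_k, 'M[C]_((sz j).+1, n.+1)),
    (forall j, K (sz j) (Xs j)) ->
    \sum_(j < k) (adjmx (V j) *m V j) = 1%:M ->
    K n (fun i => \sum_(j < k) (adjmx (V j) *m Xs j i *m V j)).

Definition mconv (g : nat) (S : ncset g) : ncset g :=
  fun n X => forall K : ncset g, mconv_closed K ->
    (forall m (Y : mtuple g m.+1), S m Y -> K m Y) -> K n X.

Definition ncpoint (g d : nat) (B : mtuple g d.+1) : ncset g :=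
  fun n X => existT (fun m => mtuple g m.+1) n X = existT _ d B.

(* unitary equivalence of tuples: U is unitary and U^* Y_i U = X_i
   (U^*U = I and UU^* = I force the sizes to agree) *)
Definition uequiv (g p q : nat) (Y : mtuple g p) (X : mtuple g q) : Prop :=
  exists U : 'M[C]_(p, q),
    adjmx U *m U = 1%:M /\ U *m adjmx U = 1%:M /\
    forall i, adjmx U *m Y i *m U = X i.

Definition dsum (g p q : nat) (X : mtuple g p) (Z : mtuple g q) : mtuple g (p + q) :=
  fun i => block_mx (X i) 0 0 (Z i).

Definition free_extreme (g : nat) (K : ncset g) : ncset g :=
  fun n X => K n X /\
    forall (k : nat) (sz : 'I_k -> nat)
           (Xs : forall j : 'I_k, mtuple g (sz j).+1)
           (V : forall j : 'I_k, 'M[C]_((sz j).+1, n.+1)),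
      (forall j, K (sz j) (Xs j)) ->
      \sum_(j < k) (adjmx (V j) *m V j) = 1%:M ->
      X = (fun i => \sum_(j < k) (adjmx (V j) *m Xs j i *m V j)) ->
      (forall j, V j != 0) ->
      forall j, uequiv (Xs j) X \/
        exists m (Z : mtuple g m.+1), K m Z /\ uequiv (Xs j) (dsum X Z).

End FreeConvexity.

(* Main.v *)
Require Import Defs.
From HB Require Import structures.
From mathcomp Require Import all_boot all_order all_algebra.
From mathcomp Require Import boolp reals.
From mathcomp Require Import complex mxtens.

(** Boundedness of [D_A] forces [I, A_1, ..., A_g] to be linearly independent,
    hence, as [g + 1 = (d + 1)^2], a basis of the full matrix algebra.  So every
    positive semidefinite matrix [Q] in a tensor product is
    [I (x) X_0 - sum_i A_i (x) X_i] for unique [X_k], obtained by slicing [Q]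
    with the dual basis [G_0, G_1, ..., G_g], and [D_A] consists of the [X]
    coming from those [Q] with [X_0 = I].  Boundedness also makes [G_0] positive
    definite; writing [G_0 = S S^*], the tuple [B_i = S^-1 G_i S^-*] satisfies
    [D_A = { sum_j V_j^* B V_j : sum_j V_j^* V_j = I }], by factoring [Q] into
    rank one terms (Choi).  The polar dual is then [D_B] at once.

    Since [I, B_1, ..., B_g] again span the matrix algebra, [B] is
    indecomposable and the only unital completely positive map fixing [B] is the
    identity, whose Kraus operators are scalars.  Hence a matrix convex
    decomposition of [B] consists of dilations of [B] by reducing isometries,
    which makes [B] the unique free extreme point. *)

Set Implicit Arguments.
Unset Strict Implicit.
Unset Printing Implicit Defensive.

Import Order.TTheory GRing.Theory Num.Theory.
Local Open Scope ring_scope.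

Local Notation "M ^H" := (adjmx M) (at level 8, format "M ^H").

(** * Adjoints, positive semidefinite matrices and isometries *)

Section Adjoint.

Variable R : realType.
Local Notation C := (R[i]).

Lemma adjmxE m n (M : 'M[C]_(m, n)) i j : M^H i j = Num.conj (M j i).
Proof. by rewrite !mxE. Qed.

Lemma adjmxK m n (M : 'M[C]_(m, n)) : M^H^H = M.
Proof. by apply/matrixP=> i j; rewrite !adjmxE conjCK. Qed.

Lemma adjmxM m n p (M : 'M[C]_(m, n)) (N : 'M[C]_(n, p)) :
  (M *m N)^H = N^H *m M^H.
Proof. by rewrite /adjmx map_mxM trmx_mul. Qed.

Lemma adjmx0 m n : (0 : 'M[C]_(m, n))^H = 0.
Proof. by rewrite /adjmx map_mx0 trmx0. Qed.

Lemma adjmxD m n (M N : 'M[C]_(m, n)) : (M + N)^H = M^H + N^H.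
Proof. by rewrite /adjmx map_mxD linearD. Qed.

Lemma adjmxN m n (M : 'M[C]_(m, n)) : (- M)^H = - M^H.
Proof. by rewrite /adjmx map_mxN linearN. Qed.

Lemma adjmxZ m n (c : C) (M : 'M[C]_(m, n)) : (c *: M)^H = Num.conj c *: M^H.
Proof. by rewrite /adjmx map_mxZ linearZ. Qed.

Lemma adjmx_sum m n (I : Type) (r : seq I) (P : pred I)
    (M : I -> 'M[C]_(m, n)) :
  (\sum_(i <- r | P i) M i)^H = \sum_(i <- r | P i) (M i)^H.
Proof. by rewrite (big_morph _ (@adjmxD m n) (adjmx0 m n)). Qed.

Lemma adjmx_scalar n (c : C) : (c%:M : 'M_n)^H = (Num.conj c)%:M.
Proof. by rewrite /adjmx map_scalar_mx tr_scalar_mx. Qed.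

Lemma adjmx1 n : (1%:M : 'M[C]_n)^H = 1%:M.
Proof. by rewrite adjmx_scalar conjC1. Qed.

Lemma adjmx_eq0 m n (M : 'M[C]_(m, n)) : (M^H == 0) = (M == 0).
Proof.
by apply/eqP/eqP=> [/(congr1 (@adjmx _ _ _))|->]; rewrite ?adjmxK ?adjmx0.
Qed.

Lemma adjmx_tens m n p q (M : 'M[C]_(m, n)) (N : 'M[C]_(p, q)) :
  (M *t N)^H = M^H *t N^H.
Proof. by rewrite /adjmx map_mxT trmx_tens. Qed.

Lemma adjmx_row m n p (M : 'M[C]_(m, n)) (N : 'M[C]_(m, p)) :
  (row_mx M N)^H = col_mx M^H N^H.
Proof. by rewrite /adjmx map_row_mx tr_row_mx. Qed.

Lemma gram_diag m n (M : 'M[C]_(m, n)) i :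
  (M^H *m M) i i = \sum_j `|M j i| ^+ 2.
Proof. by rewrite mxE; apply: eq_bigr=> j _; rewrite adjmxE normCKC. Qed.

Lemma gram_diag_ge0 m n (M : 'M[C]_(m, n)) i : 0 <= (M^H *m M) i i.
Proof. by rewrite gram_diag sumr_ge0 // => j _; rewrite exprn_ge0. Qed.

Lemma sumr_sqnorm_eq0 (I : finType) (f : I -> C) :
  \sum_i `|f i| ^+ 2 = 0 -> forall i, f i = 0.
Proof.
move=> s0 i; have /psumr_eq0P : forall j : I, true -> 0 <= `|f j| ^+ 2.
  by move=> j _; rewrite exprn_ge0.
by move=> /(_ s0 i isT)/eqP; rewrite expf_eq0 /= normr_eq0 => /eqP.
Qed.

Lemma gram_eq0 m n (M : 'M[C]_(m, n)) : M^H *m M = 0 -> M = 0.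
Proof.
move=> M0; apply/matrixP=> i j; rewrite mxE.
by apply: (sumr_sqnorm_eq0 (f := M^~ j)); rewrite -gram_diag M0 mxE.
Qed.

Lemma psd_gram m n (T : 'M[C]_(m, n)) : psd (T *m T^H).
Proof.
split=> [|v]; first by rewrite /selfadj adjmxM adjmxK.
have ->: v^H *m (T *m T^H) *m v = (T^H *m v)^H *m (T^H *m v).
  by rewrite adjmxM adjmxK !mulmxA.
exact: gram_diag_ge0.
Qed.

Lemma psd0 n : psd (0 : 'M[C]_n).
Proof.
by rewrite -(mulmx0 n (0 : 'M[C]_n)) -[X in _ *m X]adjmx0; exact: psd_gram.
Qed.

Lemma psdD n (M N : 'M[C]_n) : psd M -> psd N -> psd (M + N).
Proof.
move=> [sM pM] [sN pN]; split; first by rewrite /selfadj adjmxD sM sN.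
by move=> v; rewrite mulmxDr mulmxDl mxE addr_ge0.
Qed.

Lemma psd_sum n (I : Type) (r : seq I) (P : pred I) (M : I -> 'M[C]_n) :
  (forall i, psd (M i)) -> psd (\sum_(i <- r | P i) M i).
Proof. by move=> pM; elim/big_ind: _ => //; [exact: psd0|exact: psdD]. Qed.

Lemma psd_conj m n (M : 'M[C]_m) (V : 'M[C]_(m, n)) :
  psd M -> psd (V^H *m M *m V).
Proof.
move=> [sM pM]; split; first by rewrite /selfadj !adjmxM adjmxK sM mulmxA.
by move=> v; have := pM (V *m v); rewrite adjmxM !mulmxA.
Qed.

Lemma psdZ n (c : C) (M : 'M[C]_n) : 0 <= c -> psd M -> psd (c *: M).
Proof.
move=> c0 [sM pM]; split.
  by rewrite /selfadj adjmxZ sM geC0_conj.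
by move=> v; rewrite -scalemxAr -scalemxAl mxE mulr_ge0.
Qed.

Lemma psd_scalar n (c : C) : 0 <= c -> psd (c%:M : 'M_n).
Proof.
move=> c0; rewrite -scalemx1; apply: psdZ => //.
by rewrite -[1%:M]mulmx1 -{2}adjmx1; exact: psd_gram.
Qed.

Lemma psd_diag_ge0 n (M : 'M[C]_n) i : psd M -> 0 <= M i i.
Proof.
move=> [_ /(_ (delta_mx i 0))]; rewrite mxE (bigD1 i) //=.
rewrite big1 ?addr0 => [|j ij].
  rewrite mxE (bigD1 i) //= big1 ?addr0 => [|j ij].
    by rewrite adjmxE !mxE !eqxx conjC1 mul1r mulr1.
  by rewrite adjmxE !mxE (negPf ij) conjC0 mul0r.
by rewrite [X in _ * X]mxE (negPf ij) mulr0.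
Qed.

Lemma unitarymx_adj m n (M : 'M[C]_(m, n)) :
  M \is unitarymx -> M *m M^H = 1%:M.
Proof. by move/unitarymxP; rewrite /adjmx map_trmx. Qed.

(** Spectral theorem: each eigenvalue is the quadratic form of [M] at a unit eigenvector, hence
    nonnegative, and its square root can be taken. *)
Lemma psd_factor n (M : 'M[C]_n) : psd M -> exists T : 'M[C]_n, M = T *m T^H.
Proof.
move=> [sM pM]; pose P := spectralmx M; pose s := spectral_diag M.
have uP : P *m P^H = 1%:M by apply/unitarymx_adj/spectral_unitarymx.
have iP : invmx P = P^H.
  by rewrite invmx_unitary ?spectral_unitarymx // /adjmx map_trmx.
have eM : M = P^H *m diag_mx s *m P.
  rewrite -iP; apply/orthomx_spectralP/normalmxP.
  have -> : map_mx Num.conj M^T = M by rewrite -map_trmx.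
  by [].
have s0 i : 0 <= s 0 i.
  have <- : (P *m M *m P^H) i i = s 0 i.
    rewrite eM !mulmxA uP mul1mx -mulmxA uP mulmx1.
    by rewrite mxE eqxx mulr1n.
  have -> : (P *m M *m P^H) i i = (row i P *m M *m (row i P)^H) 0 0.
    by rewrite -row_mul !mxE; apply: eq_bigr=> j _; rewrite !mxE.
  by have := pM (row i P)^H; rewrite adjmxK.
exists (P^H *m diag_mx (map_mx sqrtC s)).
rewrite adjmxM adjmxK {1}eM -!mulmxA; congr (_ *m _); rewrite !mulmxA.
congr (_ *m _); rewrite /adjmx map_diag_mx tr_diag_mx mulmx_diag.
congr diag_mx; apply/rowP=> i; rewrite !mxE.
have /geC0_conj cs : 0 <= sqrtC (s 0 i) by rewrite sqrtC_ge0.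
by rewrite [X in _ = _ * X]cs -expr2 sqrtCK.
Qed.

(** The added columns form an orthonormal basis of the orthogonal complement of the range of [V],
    obtained by Gram-Schmidt from the left kernel of [V]. *)
Lemma isometry_complete p q (V : 'M[C]_(p, q)) : V^H *m V = 1%:M ->
  exists r (V' : 'M[C]_(p, r)),
    (row_mx V V')^H *m row_mx V V' = 1%:M /\
    row_mx V V' *m (row_mx V V')^H = 1%:M.
Proof.
move=> iV; pose W := schmidt (row_base (kermx V)).
have rV : \rank V = q.
  by apply/eqP; rewrite eqn_leq rank_leq_col -{1}(mxrank1 C q) -iV mxrankM_maxr.
have WW : W *m W^H = 1%:M.
  by apply/unitarymx_adj/schmidt_unitarymx/rank_leq_col.
have WV : W *m V = 0.
  by apply/sub_kermxP; rewrite eqmx_schmidt_free ?row_base_free ?eq_row_base.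
set r := \rank _ in W WW WV *.
have r_eq : (q + r)%N = p.
  by rewrite /r mxrank_ker rV subnKC // -rV rank_leq_row.
exists r, (W^H); set U := row_mx V W^H.
have UU : U^H *m U = 1%:M.
  rewrite adjmx_row mul_col_row iV adjmxK WW WV.
  by rewrite -(adjmxK V) -adjmxM adjmxK WV adjmx0 scalar_mx_block.
split=> //.
(* [U] is square only through the propositional equality [r_eq], so its right inverse comes from a
   rank count. *)
have fU : row_free U.
  have : \rank U = (q + r)%N.
    apply/eqP; rewrite eqn_leq rank_leq_col -{1}(mxrank1 C (q + r)) -UU.
    exact: mxrankM_maxr.
  by rewrite /row_free => ->; rewrite r_eq.
have /row_freeP[Z UZ] := fU.
by rewrite -[U^H]mulmx1 -UZ (mulmxA U^H) UU mul1mx.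
Qed.

End Adjoint.

(** * Pencils, matrix convex combinations and unitary equivalence *)

Section MatrixConvex.

Variable R : realType.
Local Notation C := (R[i]).

Lemma tensmx_sumr m n p q (I : Type) (r : seq I) (P : pred I)
    (M : 'M[C]_(m, n)) (N : I -> 'M[C]_(p, q)) :
  M *t (\sum_(i <- r | P i) N i) = \sum_(i <- r | P i) (M *t N i).
Proof.
apply/matrixP=> a b; case: (mxtens_indexP a)=> a1 a2.
case: (mxtens_indexP b)=> b1 b2.
rewrite tensmxE !summxE mulr_sumr; apply: eq_bigr=> i _.
by rewrite tensmxE.
Qed.

Lemma tensmx_suml m n p q (I : Type) (r : seq I) (P : pred I)
    (M : I -> 'M[C]_(m, n)) (N : 'M[C]_(p, q)) :
  (\sum_(i <- r | P i) M i) *t N = \sum_(i <- r | P i) (M i *t N).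
Proof.
apply/matrixP=> a b; case: (mxtens_indexP a)=> a1 a2.
case: (mxtens_indexP b)=> b1 b2.
rewrite tensmxE !summxE mulr_suml; apply: eq_bigr=> i _.
by rewrite tensmxE.
Qed.

Lemma eq_mxtens_index m n (a c : 'I_m) (b d : 'I_n) :
  (mxtens_index (a, b) == mxtens_index (c, d)) = (a == c) && (b == d).
Proof. by rewrite (can_eq (@mxtens_indexK m n)) xpair_eqE. Qed.

Lemma tensmx1 m n : (1%:M : 'M[C]_m) *t (1%:M : 'M[C]_n) = 1%:M.
Proof.
apply/matrixP=> a b; case: (mxtens_indexP a)=> a1 a2.
case: (mxtens_indexP b)=> b1 b2.
by rewrite tensmxE !mxE eq_mxtens_index -natrM mulnb.
Qed.

Lemma tensmxBl m n p q (M N : 'M[C]_(m, n)) (L : 'M[C]_(p, q)) :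
  (M - N) *t L = M *t L - N *t L.
Proof.
apply/matrixP=> a b; case: (mxtens_indexP a)=> a1 a2.
case: (mxtens_indexP b)=> b1 b2.
by rewrite tensmxE [RHS]mxE [X in _ = _ + X]mxE !tensmxE !mxE mulrBl.
Qed.

Lemma tens_scalar_r m n p (M : 'M[C]_(m, n)) (c : C) :
  M *t (c%:M : 'M_p) = (c *: M) *t 1%:M.
Proof.
apply/matrixP=> a b; case: (mxtens_indexP a)=> a1 a2.
case: (mxtens_indexP b)=> b1 b2; rewrite !tensmxE !mxE.
by rewrite mulrnAr [c * _]mulrC mulr_natr.
Qed.

Lemma psd_tens1 n p (M : 'M[C]_n) : psd M -> psd (M *t (1%:M : 'M_p)).
Proof.
move=> /psd_factor[T ->].
rewrite -[X in _ *t X]mulmx1 -{2}(adjmx1 R p) -tensmx_mul -adjmx_tens.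
exact: psd_gram.
Qed.

Section Pencil.

Variables (g k n d : nat) (sz : 'I_k -> nat).
Variables (Xs : forall j : 'I_k, mtuple R g (sz j)).
Variables (V : forall j : 'I_k, 'M[C]_(sz j, n)).
Hypothesis sumV : \sum_(j < k) ((V j)^H *m V j) = 1%:M.

(** [sumV] distributes the constant term of the pencil over the summands. This handles the variable,
    for matrix convexity of [fspec A]; [pencil_conjl] handles the coefficients, for the polar
    dual. *)
Lemma pencil_conjr (A : mtuple R g d) :
  pencil A (fun i => \sum_(j < k) ((V j)^H *m Xs j i *m V j)) =
  \sum_(j < k) ((1%:M *t V j)^H *m pencil A (Xs j) *m (1%:M *t V j)).
Proof.
have -> : pencil A (fun i => \sum_(j < k) ((V j)^H *m Xs j i *m V j)) =
    \sum_(j < k) (1%:M *t ((V j)^H *m V j)) -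
    \sum_(j < k) \sum_(i < g) (A i *t ((V j)^H *m Xs j i *m V j)).
  rewrite -tensmx_sumr sumV tensmx1 exchange_big /=; congr (_ - _).
  by apply: eq_bigr=> i _; rewrite tensmx_sumr.
rewrite -sumrB; apply: eq_bigr=> j _.
rewrite /pencil mulmxBr mulmxBl mulmx1 adjmx_tens adjmx1 tensmx_mul mulmx1.
congr (_ - _); rewrite mulmx_sumr mulmx_suml; apply: eq_bigr=> i _.
by rewrite !tensmx_mul mul1mx mulmx1.
Qed.

Lemma pencil_conjl (Y : mtuple R g d) :
  pencil (fun i => \sum_(j < k) ((V j)^H *m Xs j i *m V j)) Y =
  \sum_(j < k) ((V j *t 1%:M)^H *m pencil (Xs j) Y *m (V j *t 1%:M)).
Proof.
have -> : pencil (fun i => \sum_(j < k) ((V j)^H *m Xs j i *m V j)) Y =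
    \sum_(j < k) (((V j)^H *m V j) *t 1%:M) -
    \sum_(j < k) \sum_(i < g) (((V j)^H *m Xs j i *m V j) *t Y i).
  rewrite -tensmx_suml sumV tensmx1 exchange_big /=; congr (_ - _).
  by apply: eq_bigr=> i _; rewrite tensmx_suml.
rewrite -sumrB; apply: eq_bigr=> j _.
rewrite /pencil mulmxBr mulmxBl mulmx1 adjmx_tens adjmx1 tensmx_mul mulmx1.
congr (_ - _); rewrite mulmx_sumr mulmx_suml; apply: eq_bigr=> i _.
by rewrite !tensmx_mul mul1mx mulmx1.
Qed.

End Pencil.

Lemma fspec_mconv_closed g d (A : mtuple R g d) : mconv_closed (fspec A).
Proof.
move=> n k sz Xs V KX sumV; split=> [i|].
  rewrite /selfadj adjmx_sum; apply: eq_bigr=> j _.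
  by rewrite !adjmxM adjmxK (KX j).1 mulmxA.
rewrite (pencil_conjr Xs sumV).
by apply: psd_sum=> j; apply: psd_conj; case: (KX j).
Qed.

Lemma mconv_closed_mconv g (S : ncset R g) : mconv_closed (mconv S).
Proof.
move=> n k sz Xs V SX sumV K cK SK; apply: (cK) => // j.
exact: (SX j).
Qed.

Lemma mconv_closed1 g (K : ncset R g) p n (X : mtuple R g p.+1)
    (V : 'M[C]_(p.+1, n.+1)) :
  mconv_closed K -> K p X -> V^H *m V = 1%:M -> K n (fun i => V^H *m X i *m V).
Proof.
move=> cK KX iV.
have := cK n 1%N (fun=> p) (fun=> X) (fun=> V) (fun=> KX).
rewrite big_ord1 => /(_ iV); congr (K n _).
by apply: funext=> i; rewrite big_ord1.
Qed.

Lemma uequivC g p q (Y : mtuple R g p) (X : mtuple R g q) :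
  uequiv Y X -> uequiv X Y.
Proof.
move=> [U [UU [UU' YX]]]; exists U^H; rewrite adjmxK; split=> //; split=> //.
by move=> i; rewrite -YX !mulmxA UU' mul1mx -mulmxA UU' mulmx1.
Qed.

Lemma uequiv_refl g p (X : mtuple R g p) : uequiv X X.
Proof.
exists 1%:M; rewrite adjmx1 mulmx1; split=> //; split=> // i.
by rewrite mulmx1 mul1mx.
Qed.

Lemma uequiv_mconv_closed g (K : ncset R g) p q (Y : mtuple R g p.+1)
    (X : mtuple R g q.+1) :
  mconv_closed K -> uequiv Y X -> K p Y -> K q X.
Proof.
move=> cK [U [UU [_ YX]]] KY; have := mconv_closed1 cK KY UU.
by congr (K q _); apply: funext.
Qed.

(** The range of [Z] is invariant under the self-adjoint [Y i], hence reducing, so [Y] is block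
    diagonal in any unitary completion of [Z]. *)
Lemma intertwining_isometry g p q (Y : mtuple R g p) (X : mtuple R g q)
    (Z : 'M[C]_(p, q)) :
  SAtuple Y -> Z^H *m Z = 1%:M -> (forall i, Y i *m Z = Z *m X i) ->
  uequiv Y X \/
  exists m (W : 'M[C]_(p, m.+1)),
    W^H *m W = 1%:M /\ uequiv Y (dsum X (fun i => W^H *m Y i *m W)).
Proof.
(* An empty complement is split off: [Z] is then unitary, and levels of an [ncset] have positive
   size. *)
move=> sY iZ YZ; have [[|m] [W [UU UU']]] := isometry_complete iZ.
  left; exists Z; split=> //; split=> //; last first.
    by move=> i; rewrite -mulmxA YZ mulmxA iZ mul1mx.
  by move: UU'; rewrite adjmx_row mul_row_col (thinmx0 W) mul0mx addr0.
right; exists m, W; move: (UU).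
rewrite adjmx_row mul_col_row scalar_mx_block => /eq_block_mx[_ ZW WZ WW].
split=> //; exists (row_mx Z W); split=> //; split=> //; move=> i.
rewrite adjmx_row -mulmxA mul_mx_row mul_col_row /dsum !mulmxA.
have WYZ : W^H *m Y i *m Z = 0 by rewrite -mulmxA YZ mulmxA WZ mul0mx.
congr block_mx => //; first by rewrite -mulmxA YZ mulmxA iZ mul1mx.
by rewrite -[RHS](adjmx0 R m.+1 q) -WYZ !adjmxM adjmxK sY mulmxA.
Qed.

(** * Rigidity of tuples that span the matrix algebra together with the identity *)

Definition spanning g d (B : mtuple R g d) : Prop :=
  forall M : 'M[C]_d, exists (c0 : C) (c : 'I_g -> C),
    M = c0%:M + \sum_(i < g) c i *: B i.

(** Otherwise one unitary would make every matrix block diagonal, including the conjugate of [E],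
    whose off-diagonal block is nonzero. *)
Lemma spanning_indecomposable g d p q (B : mtuple R g d)
    (X : mtuple R g p.+1) (Y : mtuple R g q.+1) :
  spanning B -> ~ uequiv B (dsum X Y).
Proof.
move=> sB [U [UU [_ BXY]]].
pose E : 'M[C]_(p.+1 + q.+1) := block_mx 0 (const_mx 1) 0 0.
have [c0 [c cE]] := sB (U *m E *m U^H).
have : U^H *m (U *m E *m U^H) *m U = E.
  by rewrite !mulmxA UU mul1mx -mulmxA UU mulmx1.
rewrite cE mulmxDr mulmxDl mul_mx_scalar -scalemxAl UU.
rewrite mulmx_sumr mulmx_suml.
move=> /matrixP/(_ (lshift _ 0) (rshift _ 0)).
rewrite block_mxEur !mxE eq_lrshift mulr0 add0r summxE big1 => [/esym/eqP|i _].
  by rewrite oner_eq0.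
by rewrite -scalemxAr -scalemxAl BXY mxE block_mxEur mxE mulr0.
Qed.

Lemma kraus_id (I : finType) d (T : I -> 'M[C]_d) :
  (forall M, \sum_i ((T i)^H *m M *m T i) = M) ->
  exists c : I -> C, forall i, T i = (c i)%:M.
Proof.
case: d T => [|d] T TM; first by exists (fun=> 0)=> i; apply/matrixP=> [[]].
(* Testing on matrix units gives the Gram matrix of the entries of [T], seen as vectors indexed by
   [i]: off-diagonal entries have norm zero, and so do differences of diagonal ones. *)
have TE a b p q : \sum_i Num.conj (T i a p) * T i b q =
    ((p == a) && (b == q))%:R.
  have /matrixP/(_ p q) := TM (delta_mx a b).
  rewrite [RHS]mxE [b == q]eq_sym => <-.
  rewrite summxE; apply: eq_bigr=> i _.
  rewrite mxE (bigD1 b) //= big1 ?addr0 => [|l lb].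
    rewrite mxE (bigD1 a) //= big1 ?addr0 => [|l la].
      by rewrite adjmxE !mxE !eqxx mulr1.
    by rewrite !mxE (negPf la) mulr0.
  by rewrite mxE big1 ?mul0r // => j _; rewrite !mxE (negPf lb) andbF mulr0.
exists (fun i => T i 0 0)=> i; apply/matrixP=> a b; rewrite mxE.
case: eqVneq => [<-|ab]; last first.
  apply: (sumr_sqnorm_eq0 (f := fun i => T i a b)).
  under eq_bigr do rewrite normCKC.
  by rewrite TE eq_sym (negPf ab).
(* [\sum_i |T_aa - T_00|^2 = 1 - 1 - 1 + 1]. *)
rewrite mulr1n; apply/eqP; rewrite -subr_eq0; apply/eqP.
apply: (sumr_sqnorm_eq0 (f := fun i => T i a a - T i 0 0)).
under eq_bigr do rewrite normCKC rmorphB mulrBl !mulrBr.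
by rewrite !sumrB !TE !eqxx !subrr.
Qed.

(** By linearity, a map fixing the identity and a spanning tuple fixes every matrix, so [kraus_id]
    applies. *)
Lemma kraus_scalar (I : finType) g d (B : mtuple R g d) (T : I -> 'M[C]_d) :
  spanning B -> \sum_i ((T i)^H *m T i) = 1%:M ->
  (forall k, \sum_i ((T i)^H *m B k *m T i) = B k) ->
  exists c : I -> C, forall i, T i = (c i)%:M.
Proof.
move=> sB T1 TB; apply: kraus_id => M; have [c0 [c ->]] := sB M.
under eq_bigr do rewrite mulmxDr mulmxDl mul_mx_scalar -scalemxAl.
rewrite big_split /= -scaler_sumr T1 scalemx1; congr (_ + _).
under eq_bigr do rewrite mulmx_sumr mulmx_suml.
rewrite exchange_big /=; apply: eq_bigr=> k _.
under eq_bigr do rewrite -scalemxAr -scalemxAl.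
by rewrite -scaler_sumr TB.
Qed.

(* The identities [W l *m V = c l *: U^H] force [V] to intertwine [X] with
   [Y], because [V = \sum_l (W l)^H *m (W l *m V)]. *)
Lemma kraus_scalar_intertwine (I : finType) g p n d (B : mtuple R g d)
    (X : mtuple R g n) (V : 'M[C]_(p, n)) (W : I -> 'M[C]_(d, p))
    (U : 'M[C]_(n, d)) (c : I -> C) :
  U^H *m U = 1%:M -> U *m U^H = 1%:M -> (forall i, U^H *m X i *m U = B i) ->
  \sum_l ((W l)^H *m W l) = 1%:M -> (forall l, W l *m V = c l *: U^H) ->
  V^H *m V = (\sum_l `|c l| ^+ 2)%:M /\
  forall i, (\sum_l ((W l)^H *m B i *m W l)) *m V = V *m X i.
Proof.
move=> UU UU' XB W1 WV.
have V_sum : V = \sum_l c l *: ((W l)^H *m U^H).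
  rewrite -[LHS]mul1mx -W1 mulmx_suml; apply: eq_bigr=> l _.
  by rewrite -mulmxA WV -scalemxAr.
split=> [|i].
  rewrite -[V^H]mulmx1 -W1 mulmx_sumr mulmx_suml.
  rewrite -scalemx1 scaler_suml; apply: eq_bigr=> l _.
  have -> : V^H *m ((W l)^H *m W l) *m V = (W l *m V)^H *m (W l *m V).
    by rewrite adjmxM !mulmxA.
  by rewrite WV adjmxZ adjmxK -scalemxAl -scalemxAr scalerA UU' normCKC.
rewrite {2}V_sum !mulmx_suml; apply: eq_bigr=> l _.
rewrite -!mulmxA WV -!scalemxAr -scalemxAl -!mulmxA -XB; congr (_ *: (_ *m _)).
by rewrite -!mulmxA UU' mulmx1.
Qed.

Lemma mconv_sub g (K S : ncset R g) : mconv_closed K ->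
  (forall n X, S n X -> K n X) ->
  forall n (X : mtuple R g n.+1), mconv S X -> K n X.
Proof. by move=> cK SK n X; apply. Qed.

Lemma sub_mconv g (S : ncset R g) n (X : mtuple R g n.+1) : S n X -> mconv S X.
Proof. by move=> SX K _; apply. Qed.

(** * Matrix convex sets generated by a single point, and their free extreme points *)

Section GeneratedByPoint.

Variables (g d : nat) (K : ncset R g) (B : mtuple R g d.+1).
Hypothesis cK : mconv_closed K.
Hypothesis sK : forall n (X : mtuple R g n.+1), K X -> SAtuple X.
Hypothesis KB : K B.
Hypothesis genK : forall n (X : mtuple R g n.+1), K X ->
  exists k (V : 'I_k -> 'M[C]_(d.+1, n.+1)),
    \sum_j ((V j)^H *m V j) = 1%:M /\
    forall i, X i = \sum_j ((V j)^H *m B i *m V j).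

Lemma generated_mconv (S : ncset R g) : mconv S B ->
  forall n (X : mtuple R g n.+1), K X -> mconv S X.
Proof.
move=> SB n X /genK[k [V [V1 XE]]].
have := mconv_closed_mconv (fun _ => SB) V1.
by congr (mconv S _); apply: funext=> i; rewrite XE.
Qed.

Lemma generated_eq_mconv_point : ncset_eq K (mconv (ncpoint B)).
Proof.
move=> n X; split; first by apply: generated_mconv; apply: sub_mconv.
apply: mconv_sub => // m Y YB.
(* Membership is phrased on dependent pairs so that [YB] can be rewritten without inverting an
   equality of pairs. *)
pose KT (p : {m : nat & mtuple R g m.+1}) := K (projT2 p).
by have: KT (existT _ d B) by []; rewrite -YB.
Qed.

Hypothesis sB : spanning B.

(** Extremality is applied to an expression of [X] through copies of [B]; indecomposability of [B]
    excludes the direct sum alternative. *)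
Lemma free_extreme_uequiv n (X : mtuple R g n.+1) :
  free_extreme K X -> uequiv X B.
Proof.
move=> [KX eX]; have [k [V [V1 XE]]] := genK KX.
(* The definition of [free_extreme] admits only nonzero coefficients, so the zero ones are
   discarded; at least one remains because the identity has positive size. *)
pose P := [pred l | V l != 0].
pose W (j : 'I_#|P|) : 'M[C]_(d.+1, n.+1) := V (enum_val j).
have sumP (f : 'I_k -> 'M[C]_n.+1) : (forall l, V l = 0 -> f l = 0) ->
    \sum_(j < #|P|) f (enum_val j) = \sum_l f l.
  move=> f0; rewrite -(big_enum_val f) [RHS](bigID (mem P)) /=.
  by rewrite [X in _ = _ + X]big1 ?addr0 // => l; rewrite inE negbK => /eqP/f0.
have W1 : \sum_j ((W j)^H *m W j) = 1%:M.
  by rewrite (sumP (fun l => (V l)^H *m V l)) // => l ->; rewrite mulmx0.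
have WX : X = (fun i => \sum_j ((W j)^H *m B i *m W j)).
  apply: funext=> i; rewrite XE (sumP (fun l => (V l)^H *m B i *m V l)) //.
  by move=> l ->; rewrite mulmx0.
have WN0 j : W j != 0 by have := enum_valP j.
have cP : (0 < #|P|)%N.
  rewrite lt0n; apply/eqP=> P0; move: W1; rewrite big1 => [|j _].
    by move=> /matrixP/(_ 0 0)/eqP; rewrite !mxE eq_sym oner_eq0.
  by case: j => j lj; exfalso; move: lj; rewrite P0.
have [/uequivC//|[m [Z [_ BZ]]]] :=
  eX _ (fun _ => d) (fun _ => B) W (fun _ => KB) W1 WX WN0 (Ordinal cP).
by case: (spanning_indecomposable sB BZ).
Qed.

(** Expanding each [Xs l] through copies of [B] turns the decomposition of [X] into a Kraus form of
    a unital map fixing [B]. Its operators are scalars, which makes [V j] a multiple of an isometry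
    intertwining [Xs j] with [X]. *)
Lemma uequiv_free_extreme n (X : mtuple R g n.+1) :
  uequiv X B -> free_extreme K X.
Proof.
move=> XB; split; first exact: uequiv_mconv_closed cK (uequivC XB) KB.
move=> k sz Xs V KXs V1 XE VN0 j.
have [U [UU [UU' XU]]] := XB.
pose w l := cid (genK (KXs l)); pose kk l := projT1 (w l).
pose W l : 'I_(kk l) -> _ := projT1 (cid (projT2 (w l))).
have [W1 WX] : (forall l, \sum_i ((W l i)^H *m W l i) = 1%:M) /\
    forall l i, Xs l i = \sum_q ((W l q)^H *m B i *m W l q).
  by split=> l; have [] := projT2 (cid (projT2 (w l))).
pose T (p : {l : 'I_k & 'I_(kk l)}) := W (tag p) (tagged p) *m V (tag p) *m U.
have sumT (M : 'M[C]_d.+1) : \sum_p ((T p)^H *m M *m T p) =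
    U^H *m (\sum_l ((V l)^H *m (\sum_q ((W l q)^H *m M *m W l q)) *m V l)) *m U.
  rewrite mulmx_sumr mulmx_suml.
  rewrite -(sig_big_dep xpredT (fun _ => xpredT)
    (fun l q => (W l q *m V l *m U)^H *m M *m (W l q *m V l *m U))) /=.
  apply: eq_bigr=> l _; rewrite mulmx_sumr mulmx_suml mulmx_sumr mulmx_suml.
  by apply: eq_bigr=> q _; rewrite !adjmxM !mulmxA.
have [] := @kraus_scalar _ _ _ B T sB.
- transitivity (\sum_p ((T p)^H *m 1%:M *m T p)).
    by apply: eq_bigr=> p _; rewrite mulmx1.
  rewrite sumT -[RHS]UU; congr (_ *m _); rewrite -[RHS]mulmx1; congr (_ *m _).
  rewrite -V1; apply: eq_bigr=> l _; rewrite -[X in _ = X *m _]mulmx1 -(W1 l).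
  by congr (_ *m _ *m _); apply: eq_bigr=> q _; rewrite mulmx1.
- move=> i; rewrite sumT -[RHS]XU [in RHS]XE; congr (_ *m _ *m _).
  by apply: eq_bigr=> l _; rewrite WX.
move=> c Tc.
have WV q : W j q *m V j = c (Tagged _ q) *: U^H.
  have /(congr1 (mulmx^~ U^H)) := Tc (Tagged _ q).
  by rewrite /T /= -(mulmxA _ U) UU' mulmx1 mul_scalar_mx.
have [VV XV] := kraus_scalar_intertwine UU UU' XU (W1 j) WV.
set N := \sum_l _ in VV.
have N_ge0 : 0 <= N by apply: sumr_ge0=> l _; rewrite exprn_ge0.
have N_neq0 : N != 0.
  apply: contraNneq (VN0 j) => N0; apply/eqP/gram_eq0.
  by rewrite VV N0; apply/matrixP=> a b; rewrite !mxE mul0rn.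
(* [V j] has Gram matrix [N%:M] with [N] positive, so this factor makes it an isometry. *)
pose s := (sqrtC N)^-1.
have [|i|eZ|[m [Z [ZZ eZ]]]] :=
  @intertwining_isometry _ _ _ (Xs j) X (s *: V j) (sK (KXs j)).
- rewrite adjmxZ -scalemxAl -scalemxAr scalerA VV scale_scalar_mx.
  rewrite geC0_conj ?invr_ge0 ?sqrtC_ge0 // /s -invfM -expr2 sqrtCK.
  by rewrite mulVf.
- by rewrite -scalemxAr -scalemxAl -XV WX.
- by left.
(* The complementary summand is a compression of [Xs j] by an isometry, hence a point of [K]. *)
right; exists m; eexists; split; last exact: eZ.
exact: mconv_closed1 cK (KXs j) ZZ.
Qed.

Lemma free_extreme_generated n (X : mtuple R g n.+1) :
  free_extreme K X <-> uequiv X B.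
Proof. by split; [exact: free_extreme_uequiv|exact: uequiv_free_extreme]. Qed.

Lemma generated_eq_mconv_free_extreme : ncset_eq K (mconv (free_extreme K)).
Proof.
move=> n X; split; last by apply: mconv_sub => // m Y [].
apply: generated_mconv; apply: sub_mconv; apply/free_extreme_generated.
exact: uequiv_refl.
Qed.

End GeneratedByPoint.
End MatrixConvex.

(** * Dual bases of the full matrix algebra *)

Section DualBasis.

Variables (F : fieldType) (m D : nat) (E : 'I_m -> 'M[F]_D).

(** The bilinear pairing [tr (M N^T)]; it has no conjugation, so coordinates are linear in [M]. *)
Definition mxdot (M N : 'M[F]_D) : F := \sum_a \sum_b M a b * N a b.

(** The vectorized [E k] are the rows of an invertible [P], and [G k] is column [k] of its inverse.
    Both expansions are [invmx P *m P = 1%:M], acting on rows or on columns. *)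
Lemma dual_basis :
  m = (D * D)%N ->
  (forall c : 'I_m -> F, \sum_k c k *: E k = 0 -> forall k, c k = 0) ->
  exists G : 'I_m -> 'M[F]_D,
    (forall M, M = \sum_k mxdot M (G k) *: E k) /\
    (forall M, M = \sum_k mxdot M (E k) *: G k).
Proof.
move=> m_eq freeE; pose P := \matrix_k mxvec (E k).
have sum_mxvec (f : 'I_(D * D) -> F) :
    \sum_k f k = \sum_a \sum_b f (mxvec_index a b).
  rewrite pair_bigA (reindex _ (curry_mxvec_bij _ _)) /=.
  by apply: eq_bigr=> [[a b]].
have mulP (v : 'rV_m) : v *m P = mxvec (\sum_k v 0 k *: E k).
  rewrite mulmx_sum_row linear_sum; apply: eq_bigr=> k _.
  by rewrite rowK linearZ.
have uP : row_free P.
  apply: inj_row_free => v; rewrite mulP => /eqP; rewrite mxvec_eq0 => /eqP v0.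
  by apply/rowP=> k; rewrite mxE; apply: (freeE (v 0)).
have PE k a b : P k (mxvec_index a b) = E k a b by rewrite mxE mxvecE.
(* Forgetting the body of [P] allows [m] to be replaced by [D * D], which makes [P] square by
   type. *)
clearbody P; move: P mulP uP PE; subst m => P mulP.
rewrite row_free_unit => uP PE.
exists (fun k => \matrix_(a, b) invmx P (mxvec_index a b) k).
split=> M.
  apply: (can_inj mxvecK); rewrite -[LHS]mulmx1 -(mulVmx uP) mulmxA mulP.
  congr mxvec; apply: eq_bigr=> k _; rewrite mxE sum_mxvec; congr (_ *: _).
  by apply: eq_bigr=> a _; apply: eq_bigr=> b _; rewrite mxvecE mxE.
apply/matrixP=> a b; rewrite summxE -mxvecE.
have <- : (invmx P *m (P *m (mxvec M)^T)) (mxvec_index a b) 0 =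
    mxvec M 0 (mxvec_index a b) by rewrite mulKmx // mxE.
rewrite mxE; apply: eq_bigr=> k _; rewrite !mxE mulrC; congr (_ * _).
rewrite sum_mxvec; apply: eq_bigr=> i _; apply: eq_bigr=> j _.
by rewrite PE mxE mxvecE mulrC.
Qed.

End DualBasis.

(** * Consequences of boundedness: linear independence and positivity of the dual basis *)

Section Spectrahedron.

Variables (R : realType) (g d : nat).
Local Notation C := (R[i]).
Variable A : mtuple R g d.+1.
Hypothesis sA : SAtuple A.

(** The whole ray of scalar tuples [t * x] lies in level one of [fspec A]; the Archimedean property
    then contradicts the bound unless [x] vanishes. *)
Lemma bounded_recession (x : 'I_g -> C) : nc_bounded (fspec A) ->
  (forall i, x i \is Num.real) -> psd (- \sum_i x i *: A i) ->
  forall i, x i = 0.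
Proof.
move=> [r bA] xR px i.
pose X (t : nat) : mtuple R g 1 := fun i => (t%:R * x i)%:M.
have AX t : fspec A (X t).
  split=> [j|].
    have /CrealP tx : t%:R * x j \is Num.real by rewrite realM ?realn.
    by rewrite /selfadj adjmx_scalar tx.
  have -> : pencil A (X t) = (1%:M + t%:R *: (- \sum_i x i *: A i)) *t 1%:M.
    rewrite scalerN tensmxBl tensmx1 scaler_sumr tensmx_suml.
    congr (_ - _); apply: eq_bigr=> j _.
    by rewrite tens_scalar_r scalerA.
  apply/psd_tens1/psdD; first exact: psd_scalar.
  by apply: psdZ => //; rewrite ler0n.
have xE := RRe_real (xR i); set y := complex.Re (x i) in xE.
have y_bound t : t%:R * `|y| <= r.
  have [/(psd_diag_ge0 0) p1 /(psd_diag_ge0 0) p2] := bA _ _ (AX t) i.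
  move: p1 p2; rewrite /X -xE !mxE /= !mulr1n.
  rewrite -(rmorph_nat (@real_complex R)) -rmorphM -rmorphB -rmorphD !lecR.
  move=> p1 p2; rewrite -[t%:R]ger0_norm ?ler0n // -normrM ler_norml.
  by rewrite -subr_ge0 opprK addrC p2 -subr_ge0 p1.
suff y_eq0 : y = 0 by rewrite -xE y_eq0.
apply/eqP; apply: contraT => yN0.
have y0 : 0 < `|y| by rewrite normr_gt0.
have r0 : 0 <= r by have := y_bound 0%N; rewrite mul0r.
have := archi_boundP (divr_ge0 r0 (ltW y0)).
by rewrite ltr_pdivrMr // ltNge y_bound.
Qed.

Hypothesis bA : nc_bounded (fspec A).

(* The pencil at [X] has coordinates [I, X_1, ..., X_g] in the basis
   [I, - A_1, ..., - A_g]. *)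
Definition pencil_coef (k : 'I_g.+1) : 'M[C]_d.+1 :=
  if unlift ord0 k is Some i then - A i else 1%:M.

Local Notation E := pencil_coef.

Lemma pencil_coef0 : E ord0 = 1%:M.
Proof. by rewrite /pencil_coef unlift_none. Qed.

Lemma pencil_coefS i : E (lift ord0 i) = - A i.
Proof. by rewrite /pencil_coef liftK. Qed.

Lemma pencil_coef_adj k : (E k)^H = E k.
Proof.
by rewrite /pencil_coef; case: unliftP => [i|] _; rewrite ?adjmx1 ?adjmxN ?sA.
Qed.

Lemma pencil_coef_sum (c : 'I_g.+1 -> C) :
  \sum_k c k *: E k = (c ord0)%:M - \sum_i c (lift ord0 i) *: A i.
Proof.
rewrite big_ord_recl pencil_coef0 scalemx1 -sumrN; congr (_ + _).
by apply: eq_bigr=> i _; rewrite pencil_coefS scalerN.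
Qed.

(** A real relation reads [c_0 I = sum_i c_i A_i]; according to the sign of [c_0], the tuple [- c_i]
    or [c_i] is a recession direction, hence zero. *)
Lemma pencil_coef_free_real (c : 'I_g.+1 -> C) :
  (forall k, c k \is Num.real) -> \sum_k c k *: E k = 0 -> forall k, c k = 0.
Proof.
move=> cR; rewrite pencil_coef_sum => /eqP; rewrite subr_eq0 => /eqP cA.
have cS i : c (lift ord0 i) = 0.
  have [c0|c0] := real_ge0P (cR ord0).
    apply/eqP; rewrite -oppr_eq0; apply/eqP; move: i.
    apply: bounded_recession => // [i|]; first by rewrite realN.
    under eq_bigr do rewrite scaleNr.
    by rewrite sumrN opprK -cA; apply: psd_scalar.
  move: i; apply: bounded_recession => //.
  by rewrite -cA -raddfN; apply: psd_scalar; rewrite oppr_ge0 ltW.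
move=> k; case: (unliftP ord0 k) => [i|] -> //.
move: cA; rewrite big1 => [/matrixP/(_ 0 0)|i _]; last by rewrite cS scale0r.
by rewrite !mxE.
Qed.

(** Since the [E k] are self-adjoint, conjugating the coefficients preserves a relation, so real and
    imaginary parts reduce to the real case. *)
Lemma pencil_coef_free (c : 'I_g.+1 -> C) :
  \sum_k c k *: E k = 0 -> forall k, c k = 0.
Proof.
move=> cE.
have cE' : \sum_k Num.conj (c k) *: E k = 0.
  transitivity (\sum_k c k *: E k)^H; last by rewrite cE adjmx0.
  by rewrite adjmx_sum; apply: eq_bigr=> k _; rewrite adjmxZ pencil_coef_adj.
have re k : c k + Num.conj (c k) = 0.
  move: k; apply: pencil_coef_free_real => [k|].
    by apply/CrealP; rewrite rmorphD /= conjCK addrC.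
  under eq_bigr do rewrite scalerDl.
  by rewrite big_split /= cE cE' addr0.
have im k : 'i * (c k - Num.conj (c k)) = 0.
  move: k; apply: pencil_coef_free_real => [k|].
    apply/CrealP; rewrite rmorphM rmorphB /= conjCK conjCi.
    by rewrite mulNr -mulrN opprB.
  under eq_bigr do rewrite -scalerA scalerBl.
  by rewrite -scaler_sumr sumrB cE cE' subrr scaler0.
move=> k; have /eqP := im k; rewrite mulf_eq0 (negPf (neq0Ci _)) /= subr_eq0.
move=> /eqP cc; have := re k; rewrite -cc -mulr2n => /eqP.
by rewrite mulrn_eq0 => /eqP.
Qed.

Lemma tens_pencil_coef_inj n (Y Z : 'I_g.+1 -> 'M[C]_n) :
  \sum_k E k *t Y k = \sum_k E k *t Z k -> forall k, Y k = Z k.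
Proof.
move=> YZ k; apply/matrixP=> i j; apply/eqP; rewrite -subr_eq0; apply/eqP.
move: k; apply: (pencil_coef_free (c := fun k => Y k i j - Z k i j)).
under eq_bigr do rewrite scalerBl.
rewrite sumrB; apply/eqP; rewrite subr_eq0; apply/eqP/matrixP=> a b.
have /matrixP/(_ (mxtens_index (a, i)) (mxtens_index (b, j))) := YZ.
rewrite !summxE => YZab.
transitivity (\sum_k (E k *t Y k) (mxtens_index (a, i)) (mxtens_index (b, j))).
  by apply: eq_bigr=> k _; rewrite tensmxE mxE mulrC.
by rewrite YZab; apply: eq_bigr=> k _; rewrite tensmxE mxE mulrC.
Qed.

Definition homogenize n (X : mtuple R g n) (k : 'I_g.+1) : 'M[C]_n :=
  if unlift ord0 k is Some i then X i else 1%:M.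

Lemma pencil_homogenize n (X : mtuple R g n) :
  pencil A X = \sum_k E k *t homogenize X k.
Proof.
rewrite big_ord_recl pencil_coef0 /homogenize unlift_none tensmx1 /pencil.
rewrite -sumrN; congr (_ + _); apply: eq_bigr=> i _.
by rewrite liftK pencil_coefS -[- A i]sub0r tensmxBl tens0mx sub0r.
Qed.

Variable G : 'I_g.+1 -> 'M[C]_d.+1.
Hypothesis expandE : forall M, M = \sum_k mxdot M (G k) *: E k.
Hypothesis expandG : forall M, M = \sum_k mxdot M (E k) *: G k.

(** Both sides are coordinates of [M^H] in the self-adjoint basis [E]. *)
Lemma mxdot_adj M k : mxdot M^H (G k) = Num.conj (mxdot M (G k)).
Proof.
apply/eqP; rewrite -subr_eq0; apply/eqP; move: k.
apply: (pencil_coef_free (c := fun k => _ - _)).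
under eq_bigr do rewrite scalerBl.
rewrite sumrB -expandE {1}(expandE M) adjmx_sum -sumrB big1 // => k _.
by rewrite adjmxZ pencil_coef_adj subrr.
Qed.

Lemma mxdot_delta (M : 'M[C]_d.+1) a b : mxdot (delta_mx a b) M = M a b.
Proof.
rewrite /mxdot (bigD1 a) //= [X in _ + X]big1 ?addr0 => [|i ia]; last first.
  by rewrite big1 // => j _; rewrite mxE (negPf ia) mul0r.
rewrite (bigD1 b) //= big1 ?addr0 => [|j jb]; first by rewrite mxE !eqxx mul1r.
by rewrite mxE (negPf jb) andbF mul0r.
Qed.

Lemma dual_selfadj k : selfadj (G k).
Proof.
apply/matrixP=> a b; rewrite adjmxE -!mxdot_delta -mxdot_adj.
congr (mxdot _ _); apply/matrixP=> i j; rewrite adjmxE !mxE andbC.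
by rewrite rmorph_nat.
Qed.

(** The quadratic form is the coordinate along the identity of a rank one positive [M]. Were it
    nonpositive, the other coordinates would be a recession direction, hence zero, and [M] would be
    a nonpositive multiple of the identity. *)
Lemma dual0_posdef (w : 'cV[C]_d.+1) : w != 0 -> 0 < (w^H *m G ord0 *m w) 0 0.
Proof.
(* The conjugate of [w] is taken because [mxdot] does not conjugate. *)
move=> w0; pose u : 'cV[C]_d.+1 := map_mx Num.conj w; pose M := u *m u^H.
have pM : psd M by exact: psd_gram.
have ME a b : M a b = Num.conj (w a 0) * w b 0.
  by rewrite mxE big_ord1 adjmxE !mxE conjCK.
have -> : (w^H *m G ord0 *m w) 0 0 = mxdot M (G ord0).
  rewrite mxE /mxdot exchange_big /=; apply: eq_bigr=> b _.
  rewrite mxE mulr_suml; apply: eq_bigr=> a _.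
  by rewrite adjmxE ME mulrAC.
have cR k : mxdot M (G k) \is Num.real by apply/CrealP; rewrite -mxdot_adj pM.1.
rewrite real_ltNge ?real0 //; apply/negP=> c0.
have := expandE M; rewrite pencil_coef_sum => Mexp.
have cS : forall i, mxdot M (G (lift ord0 i)) = 0.
  apply: bounded_recession => //.
  have -> : - \sum_i mxdot M (G (lift ord0 i)) *: A i =
      M + (- mxdot M (G ord0))%:M.
    by rewrite [X in _ = X + _]Mexp raddfN /= addrAC subrr add0r.
  by apply: psdD => //; apply: psd_scalar; rewrite oppr_ge0.
move/negP: w0; apply; apply/eqP/matrixP=> a b; rewrite (ord1 b) [RHS]mxE.
apply/eqP; rewrite -normr_eq0 -sqrf_eq0 eq_le exprn_ge0 // andbT.
rewrite normCKC -ME Mexp big1 => [|i _]; last by rewrite cS scale0r.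
by rewrite subr0 mxE eqxx.
Qed.

Lemma dual0_factor : exists2 S : 'M[C]_d.+1, S \in unitmx & G ord0 = S *m S^H.
Proof.
have pG : psd (G ord0).
  split=> [|v]; first exact: dual_selfadj.
  have [->|v0] := eqVneq v 0; first by rewrite mulmx0 mxE.
  exact/ltW/dual0_posdef.
have [S GS] := psd_factor pG; exists S => //.
rewrite -row_free_unit; apply: inj_row_free => v vS.
apply/eqP; rewrite -adjmx_eq0; apply: contraT => /dual0_posdef.
by rewrite adjmxK GS !mulmxA vS !mul0mx mxE ltxx.
Qed.

(** For fixed indices [i], [j] of the second tensor factor, the slice of [T *m T^H] is expanded in
    [E]; columns of [T] reshaped as matrices then act on the [G k] like Kraus operators. *)
Lemma gram_expand n p (T : 'M[C]_(d.+1 * n, p)) :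
  T *m T^H = \sum_k E k *t
    (\sum_l (\matrix_(i, a) T (mxtens_index (a, i)) l) *m G k *m
      (\matrix_(i, a) T (mxtens_index (a, i)) l)^H).
Proof.
apply/matrixP=> ai bj; case: (mxtens_indexP ai)=> a i.
case: (mxtens_indexP bj)=> b j.
pose M := \matrix_(a, b) (T *m T^H) (mxtens_index (a, i)) (mxtens_index (b, j)).
transitivity (M a b); first by rewrite [RHS]mxE.
rewrite {1}(expandE M) !summxE; apply: eq_bigr=> k _.
rewrite tensmxE mxE mulrC; congr (_ * _); rewrite summxE /mxdot.
under eq_bigr do under eq_bigr do rewrite !mxE mulr_suml.
under eq_bigr do rewrite exchange_big.
rewrite exchange_big /=; apply: eq_bigr=> l _.
rewrite exchange_big mxE /=; apply: eq_bigr=> b' _.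
rewrite [X in _ = X * _]mxE mulr_suml; apply: eq_bigr=> a' _.
by rewrite !adjmxE !mxE mulrAC.
Qed.

(** * The generating point of the spectrahedron *)

Section Generator.

Variable S : 'M[C]_d.+1.
Hypotheses (uS : S \in unitmx) (GS : G ord0 = S *m S^H).

(** This conjugation normalizes [G ord0] to the identity, the coordinate 0 of a homogenized
    tuple. *)
Definition generator : mtuple R g d.+1 := fun i =>
  invmx S *m G (lift ord0 i) *m (invmx S)^H.

Local Notation B := generator.

Let adjS_inv : S^H *m (invmx S)^H = 1%:M.
Proof. by rewrite -adjmxM mulVmx // adjmx1. Qed.

Let adjS_invl : (invmx S)^H *m S^H = 1%:M.
Proof. by rewrite -adjmxM mulmxV // adjmx1. Qed.

Lemma generator_homogenize k :
  homogenize B k = invmx S *m G k *m (invmx S)^H.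
Proof.
rewrite /homogenize; case: unliftP => [i|] -> //.
by rewrite GS mulmxA mulVmx // mul1mx adjS_inv.
Qed.

Lemma generator_SAtuple : SAtuple B.
Proof.
by move=> i; rewrite /selfadj !adjmxM adjmxK dual_selfadj mulmxA.
Qed.

(** The pencil at [B] has rank one: it is [T *m T^H] for the vectorization [T] of [invmx S]. *)
Lemma generator_fspec : fspec A B.
Proof.
split; first exact: generator_SAtuple.
pose T : 'M[C]_(d.+1 * d.+1, 1) :=
  \matrix_(ai, _) invmx S (mxtens_unindex ai).2 (mxtens_unindex ai).1.
suff -> : pencil A B = T *m T^H by exact: psd_gram.
rewrite pencil_homogenize gram_expand; apply: eq_bigr=> k _.
rewrite big_ord1 generator_homogenize.
suff <- : invmx S = \matrix_(i, a) T (mxtens_index (a, i)) 0 by [].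
by apply/matrixP=> i a; rewrite !mxE mxtens_indexK.
Qed.

(** [S *m M *m S^H] is expanded in the dual basis [G], and the conjugation is undone. *)
Lemma generator_spanning : spanning B.
Proof.
move=> M; pose c k := mxdot (S *m M *m S^H) (E k).
have : S *m M *m S^H = \sum_k c k *: G k by exact: expandG.
rewrite big_ord_recl => cM.
exists (c ord0), (fun i => c (lift ord0 i)).
have -> : M = invmx S *m (S *m M *m S^H) *m (invmx S)^H.
  by rewrite !mulmxA mulVmx // mul1mx -mulmxA adjS_inv mulmx1.
rewrite cM mulmxDr mulmxDl -scalemxAr -scalemxAl; congr (_ + _).
  by rewrite GS mulmxA mulVmx // mul1mx adjS_inv scalemx1.
rewrite mulmx_sumr mulmx_suml; apply: eq_bigr=> i _.
by rewrite -scalemxAr -scalemxAl.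
Qed.

(* A factorization of the Choi-type matrix [pencil A X] gives Kraus operators
   of a unital completely positive map sending [generator] to [X]. *)
Lemma generator_generates n (X : mtuple R g n.+1) : fspec A X ->
  exists k (V : 'I_k -> 'M[C]_(d.+1, n.+1)),
    \sum_j ((V j)^H *m V j) = 1%:M /\
    forall i, X i = \sum_j ((V j)^H *m B i *m V j).
Proof.
move=> [_ /psd_factor[T]]; rewrite pencil_homogenize gram_expand.
move=> /tens_pencil_coef_inj XE.
pose W l : 'M[C]_(n.+1, d.+1) := \matrix_(i, a) T (mxtens_index (a, i)) l.
exists (d.+1 * n.+1)%N, (fun l => S^H *m (W l)^H); split=> [|i].
  have := XE ord0; rewrite /homogenize unlift_none => ->.
  by apply: eq_bigr=> l _; rewrite adjmxM !adjmxK GS !mulmxA.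
have := XE (lift ord0 i); rewrite /homogenize liftK => ->.
apply: eq_bigr=> l _; rewrite adjmxM !adjmxK /generator !mulmxA.
by rewrite -(mulmxA _ S) mulmxV // mulmx1 -(mulmxA _ _ S^H) adjS_invl mulmx1.
Qed.

End Generator.

End Spectrahedron.

(** * The polar dual, and assembly of the conclusions *)

Lemma free_polar_generated (R : realType) g d (K : ncset R g)
    (B : mtuple R g d.+1) :
  K d B ->
  (forall n (X : mtuple R g n.+1), K n X ->
    exists k (V : 'I_k -> 'M[R[i]]_(d.+1, n.+1)),
      \sum_j ((V j)^H *m V j) = 1%:M /\
      forall i, X i = \sum_j ((V j)^H *m B i *m V j)) ->
  ncset_eq (fpolar K) (fspec B).
Proof.
move=> KB genK n X; split=> [[sX pX]|[sX pX]]; split=> //; first exact: pX.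
move=> m Y /genK[k [V [V1 YE]]].
have -> : Y = fun i => \sum_j ((V j)^H *m B i *m V j) by apply: funext.
(* The pencil of any [Y] in [K] is a sum of conjugates of the pencil of [B], so testing at [B]
   suffices. *)
rewrite (pencil_conjl (fun _ => B) V1).
by apply: psd_sum => j; apply: psd_conj.
Qed.

Theorem mainTheorem19 (R : realType) (d : nat)
    (A : mtuple R (d.+1 ^ 2 - 1)%N d.+1) :
  SAtuple A ->
  nc_bounded (fspec A) ->
  exists B : mtuple R (d.+1 ^ 2 - 1)%N d.+1,
    SAtuple B /\
    ncset_eq (fpolar (fspec A)) (fspec B) /\
    ncset_eq (fspec A) (mconv (ncpoint B)) /\
    (forall n (X : mtuple R (d.+1 ^ 2 - 1)%N n.+1),
       free_extreme (fspec A) X <-> uequiv X B) /\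
    ncset_eq (fspec A) (mconv (free_extreme (fspec A))).
Proof.
move=> sA bA.
(* The identity and the [A i] are as many as the dimension of the matrix algebra, so independence
   makes them a basis. *)
have gE : (d.+1 ^ 2 - 1).+1 = (d.+1 * d.+1)%N.
  by rewrite subn1 prednK ?expn_gt0.
have [G [expandE expandG]] := dual_basis gE (pencil_coef_free sA bA).
have [S uS GS] := dual0_factor sA bA expandE.
have KB := generator_fspec sA bA expandE uS GS.
have genK := @generator_generates _ _ _ _ sA bA _ expandE _ uS GS.
have sB := generator_spanning expandG uS GS.
have cK := fspec_mconv_closed (A := A).
have sK n (X : mtuple R _ n.+1) : fspec A X -> SAtuple X by case.
exists (generator G S); split; first exact: (generator_SAtuple sA bA expandE).
split; first exact: free_polar_generated KB genK.
split; first exact: generated_eq_mconv_point cK KB genK.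
split; first by move=> n X; exact: (free_extreme_generated cK sK KB genK sB X).
exact: generated_eq_mconv_free_extreme cK sK KB genK sB.
Qed.
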